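(* Let $n$ be a positive integer and let $P=(p_1,\dots,p_n)$, $Q=(q_1,\dots,q_n)$, $R=(r_1,\dots,r_n)$ be elements of $[1,\infty)^n$ satisfying \[ \frac1{p_j}+\frac1{q_j}=\frac1{r_j}+1,\quad j=1,\dots,n. \] If $f\in L^P$ and $g\in L^Q$ are real-valued functions on $\mathbb R^n$, then the convolution $f*g(x)=\int_{\mathbb R^n}f(x-t)g(t)\,dt$ is well defined (the integral exists for almost every $x\in\mathbb R^n$), and \[ \|f*g\|_{L^R}\le\|f\|_{L^P}\,\|g\|_{L^Q}. \]
   Context: For $P=(p_1,\dots,p_n)\in[1,\infty)^n$ and a Lebesgue measurable function $f$ on $\mathbb R^n$, the mixed norm is \[ \|f\|_{L^P}=\left(\int_{\mathbb R}\dots\left(\int_{\mathbb R}\left(\int_{\mathbb R}|f(t_1,\dots,t_n)|^{p_1}\,dt_1\right)^{p_2/p_1}dt_2\right)^{p_3/p_2}\dots\,dt_n\right)^{1/p_n}, \] with the integral in $t_1$ (exponent $p_1$) innermost and the integral in $t_n$ (exponent $p_n$) outermost. $L^P$ is the set of Lebesgue measurable functions $f$ on $\mathbb R^n$ with $\|f\|_{L^P}<\infty$. *)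

(* Defs.v *)
From HB Require Import structures.
From mathcomp Require Import all_boot all_order all_algebra.
From mathcomp Require Import all_classical all_reals all_analysis.

Set Implicit Arguments.
Unset Strict Implicit.
Unset Printing Implicit Defensive.
Import Order.TTheory GRing.Theory Num.Theory.
Local Open Scope classical_set_scope.
Local Open Scope ring_scope.
Local Open Scope ereal_scope.

(* R^n is the type of n-tuples, with t_1, ..., t_n listed from the head.
   [measurableTypeR R] is R with its Borel sigma-algebra, so that the canonical
   sigma-algebra of [borelRn R n] is the Borel sigma-algebra of R^n. *)
Notation borelRn R n := (n.-tuple (measurableTypeR R)).

Definition tcons (R : realType) (n : nat) (z : measurableTypeR R * borelRn R n) :
  borelRn R n.+1 := [tuple of z.1 :: z.2].

Definition tuncons (R : realType) (n : nat) (t : borelRn R n.+1) :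
  measurableTypeR R * borelRn R n := (thead t, [tuple of behead t]).

Lemma tconsK (R : realType) (n : nat) : cancel (@tcons R n) (@tuncons R n).
Proof. by case=> x t; congr (_, _); apply: val_inj. Qed.

Lemma measurable_tcons (R : realType) (n : nat) :
  measurable_fun [set: measurableTypeR R * borelRn R n] (@tcons R n).
Proof.
by apply: measurable_cons; [exact: measurable_fst|exact: measurable_snd].
Qed.

Lemma measurable_tuncons (R : realType) (n : nat) :
  measurable_fun [set: borelRn R n.+1] (@tuncons R n).
Proof.
apply/measurable_fun_pair; last exact: measurable_behead.
exact: (@measurable_tnth _ (measurableTypeR R) n.+1 ord0).
Qed.

Section borel_lebesgue_step.
Context (R : realType) (n : nat).
Variable m : {sigma_finite_measure set (borelRn R n) -> \bar R}.

Definition borel_lebesgue_step : set (borelRn R n.+1) -> \bar R :=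
  pushforward (lebesgue_measure \x m) (@tcons R n).

Let m0 : borel_lebesgue_step set0 = 0.
Proof. by rewrite /borel_lebesgue_step /pushforward preimage_set0 measure0. Qed.

Let m_ge0 A : 0 <= borel_lebesgue_step A.
Proof. exact: (measure_ge0 (lebesgue_measure \x m)). Qed.

Let m_sigma_additive : semi_sigma_additive borel_lebesgue_step.
Proof.
apply: (@measure_semi_sigma_additive _ _ _
  (measure_function_pushforward__canonical__measure_function_Measure
     (lebesgue_measure \x m) (@measurable_tcons R n))).
Qed.

HB.instance Definition _ := isMeasure.Build _ _ _ borel_lebesgue_step
  m0 m_ge0 m_sigma_additive.

Let m_sigma_finite : sigma_finite [set: borelRn R n.+1] borel_lebesgue_step.
Proof.
have /sigma_finiteP[F [FT ndF Ffin]] := sigma_finiteT (@lebesgue_measure R).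
have /sigma_finiteP[G [GT ndG Gfin]] := sigma_finiteT m.
exists (fun k => @tuncons R n @^-1` (F k `*` G k)).
  rewrite -preimage_bigcup -[LHS](preimage_setT (@tuncons R n)); congr (_ @^-1` _).
  rewrite -setXTT FT GT predeqE => -[x y]; split; last first.
    by move=> [/= k _ []/= ? ?]; split; exists k.
  move=> [/= [i _ Fx] [j _ Gy]]; exists (maxn i j) => //; split.
  - by move: x Fx; exact/subsetPset/ndF/leq_maxl.
  - by move: y Gy; exact/subsetPset/ndG/leq_maxr.
move=> k; have [mF Fk] := Ffin k; have [mG Gk] := Gfin k; split.
  rewrite -[X in measurable X]setTI; apply: measurable_tuncons => //.
  exact: measurableX.
rewrite /borel_lebesgue_step /pushforward -comp_preimage.
rewrite (_ : @tuncons R n \o @tcons R n = id); last first.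
  by apply/funext => z; exact: tconsK.
by rewrite preimage_id product_measure1E// lte_mul_pinfty// ge0_fin_numE.
Qed.

HB.instance Definition _ := Measure_isSigmaFinite.Build _ _ _ borel_lebesgue_step
  m_sigma_finite.

End borel_lebesgue_step.

(* Lebesgue measure on the Borel sets of R^n: the n-fold product of the
   one-dimensional Lebesgue measure. *)
Fixpoint borel_lebesgue (R : realType) (n : nat) :
    {sigma_finite_measure set (borelRn R n) -> \bar R} :=
  if n is k.+1 then borel_lebesgue_step (borel_lebesgue R k)
  else \d_ ([tuple] : borelRn R 0).

(* R^n with the Lebesgue sigma-algebra, i.e. the sets that are
   Caratheodory-measurable for the outer measure of [borel_lebesgue]; this is
   the n-dimensional analogue of the library's [completed_lebesgue_measure]. *)
Definition lebesgueRn (R : realType) (n : nat) :=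
  caratheodory_type (borel_lebesgue R n)^*%mu.

HB.instance Definition _ (R : realType) (n : nat) :=
  Measurable.on (lebesgueRn R n).

Definition lebesgue_Rn (R : realType) (n : nat) :
    set (lebesgueRn R n) -> \bar R :=
  @completed_measure_extension _ _ _ (borel_lebesgue R n).

HB.instance Definition _ (R : realType) (n : nat) :=
  Measure.on (@lebesgue_Rn R n).

Definition lebesgue_measurable (R : realType) (n : nat) (f : n.-tuple R -> R) :=
  measurable_fun [set: lebesgueRn R n] (f : lebesgueRn R n -> R).

(* Integrates out the first variable, raising F to the power p_1 / p0, where p0
   is the exponent of the variable integrated just before; once no variable is
   left, takes the power 1 / p0. *)
Fixpoint mixed_norm_rec (R : realType) (n : nat) (p0 : R) :
    n.-tuple R -> (n.-tuple R -> \bar R) -> \bar R :=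
  if n is k.+1 then fun p F =>
    mixed_norm_rec (thead p) [tuple of behead p]
      (fun t : k.-tuple R =>
         \int[completed_lebesgue_measure]_s
           (F [tuple of s :: t] `^ (thead p / p0)))
  else fun _ F => F [tuple] `^ p0^-1.

(* Starting from p0 = 1, the innermost integrand is |f| ^ p_1. On functions that
   are only Lebesgue measurable, a section may fail to be measurable for a null
   set of values of the remaining variables; the library integral is total and
   the outer integrals do not depend on the values on null sets. *)
Definition mixed_norm (R : realType) (n : nat) (p : n.-tuple R)
    (f : n.-tuple R -> R) : \bar R :=
  mixed_norm_rec 1%R p (fun t => `|f t|%:E).

Definition mixedL (R : realType) (n : nat) (p : n.-tuple R) :
    set (n.-tuple R -> R) :=
  [set f | lebesgue_measurable f /\ mixed_norm p f < +oo].

Definition tsub (R : realType) (n : nat) (x t : n.-tuple R) : n.-tuple R :=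
  [tuple (tnth x i - tnth t i)%R | i < n].

Definition convolution_integrand (R : realType) (n : nat) (f g : n.-tuple R -> R)
    (x t : n.-tuple R) : R :=
  (f (tsub x t) * g t)%R.

(* [Rintegral] is the real part [fine] of the extended integral: the value is
   irrelevant at points where the integrand is not integrable. *)
Definition convolution (R : realType) (n : nat) (f g : n.-tuple R -> R)
    (x : n.-tuple R) : R :=
  (\int[@lebesgue_Rn R n]_t convolution_integrand f g x t)%R.

(* Main.v *)
Require Import Defs.
From mathcomp Require Import all_boot all_order all_algebra.
From mathcomp Require Import all_classical all_reals all_analysis.
From mathcomp Require Import measurable_realfun ring lra.
Import Order.TTheory GRing.Theory Num.Theory.
Import HBNNSimple.
Set Implicit Arguments.
Unset Strict Implicit.
Unset Printing Implicit Defensive.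
Local Open Scope classical_set_scope.
Local Open Scope ring_scope.
Local Open Scope ereal_scope.

(* Induction on the dimension. Integrating out the first variable, Minkowski's
   integral inequality followed by Young's inequality on the line bounds the
   [L^{r_1}] norm of [f * g] in [x_1] by the [(n - 1)]-dimensional convolution of
   the [L^{p_1}] and [L^{q_1}] norms of the sections of [f] and [g]. This is run
   for Borel functions with values in [[0, +oo]]. A Lebesgue measurable function
   equals a Borel one off a Borel null set; changing [f] and [g] on null sets
   changes neither the mixed norms nor, by invariance of the measure under
   [t |-> x - t], the value of the convolution at any point [x]. *)

(** * Hölder's and Minkowski's inequalities in [[0, +oo]] *)

(** A section norm can be [+oo] for some values of the remaining variables even when the full mixed
    norm is finite, and a section of a Lebesgue measurable function need not be measurable. Neither
    defect can be excluded inside an induction on the dimension. Admitting the value [+oo] removes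
    the first, and passing to Borel functions removes the second. The price is that the conventions
    [0 * +oo = 0] and those for powers of [0] and [+oo] have to be respected in every inequality.
    Existence of the convolution is then a consequence of the estimate and not a preliminary to it:
    the convolution of [|f|] and [|g|] always makes sense in [[0, +oo]], its mixed norm is finite by
    the inequality, and a function of finite mixed norm is [+oo] only on a null set. *)

Lemma lee_poweR (R : realType) (a : R) (x y : \bar R) :
  (0 <= a)%R -> 0 <= x -> x <= y -> x `^ a <= y `^ a.
Proof.
move=> a0 x0 xy; apply: gt0_ler_poweR => //; rewrite in_itv/= ?leey ?x0//.
by rewrite (le_trans x0 xy).
Qed.

Lemma measurable_fun_poweR d (T : measurableType d) (R : realType)
    (F : T -> \bar R) (a : R) :
  measurable_fun [set: T] F -> measurable_fun [set: T] (fun x => F x `^ a).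
Proof. by move=> mF; exact: (measurableT_comp (measurable_poweR a) mF). Qed.

Section hoelder.
Context d (T : measurableType d) (R : realType).
Variable mu : {measure set T -> \bar R}.
Implicit Types (u v w : T -> \bar R) (a b c : R).

Lemma ge0_integral_eq0_ae u (mu_ : measurable_fun [set: T] u) :
  (forall x, 0 <= u x) -> \int[mu]_x u x = 0 -> {ae mu, forall x, u x = 0}.
Proof.
move=> u0 iu.
have : \int[mu]_x `|u x| = 0.
  by rewrite -iu; apply: eq_integral => x _; rewrite gee0_abs.
move/(ae_eq_integral_abs mu measurableT mu_).
by apply: filterS => x /(_ I).
Qed.

(** This is Hölder with conjugate exponents [a^-1] and [(1 - a)^-1] for [u ^ a] and [v ^ (1 - a)].
    Written with weights, the inequality keeps a meaning at [a = 0] and [a = 1], where one exponent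
    would be infinite. *)
Lemma hoelder_EFin (u v : T -> R) a : (0 < a < 1)%R ->
  measurable_fun [set: T] u -> measurable_fun [set: T] v ->
  (forall x, 0 <= u x)%R -> (forall x, 0 <= v x)%R ->
  \int[mu]_x ((u x)%:E `^ a * (v x)%:E `^ (1 - a)) <=
  (\int[mu]_x (u x)%:E) `^ a * (\int[mu]_x (v x)%:E) `^ (1 - a).
Proof.
move=> /andP[a0 a1] mu_ mv u0 v0.
have b0 : (0 < 1 - a)%R by rewrite subr_gt0.
have /= := @hoelder d T R mu (fun x => powR (u x) a) (fun x => powR (v x) (1 - a))
  a^-1 (1 - a)^-1.
have -> : ((a^-1)^-1 + ((1 - a)^-1)^-1 = 1)%R by rewrite !invrK addrC subrK.
move=> /(_ _ _ _ _ erefl).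
rewrite Lnorm1 unlock !invrK => h.
have h1 : \int[mu]_x (u x)%:E = \int[mu]_x (`|(powR (u x) a)%:E| `^ a^-1).
  apply: eq_integral => x _; rewrite gee0_abs ?lee_fin ?powR_ge0//.
  by rewrite -poweR_EFin -poweRrM divff ?gt_eqF// poweRe1 ?lee_fin.
have h2 : \int[mu]_x (v x)%:E =
    \int[mu]_x (`|(powR (v x) (1 - a))%:E| `^ (1 - a)^-1).
  apply: eq_integral => x _; rewrite gee0_abs ?lee_fin ?powR_ge0//.
  by rewrite -poweR_EFin -poweRrM divff ?gt_eqF// poweRe1 ?lee_fin.
rewrite h1 h2; apply: le_trans (h _ _ _ _); last 4 first.
- exact: (measurableT_comp (measurable_powR _)).
- exact: (measurableT_comp (measurable_powR _)).
- by rewrite invr_gt0.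
- by rewrite invr_gt0.
rewrite le_eqVlt; apply/orP; left; apply/eqP; apply: eq_integral => x _.
by rewrite gee0_abs// lee_fin mulr_ge0 ?powR_ge0.
Qed.

Lemma hoelder2_ereal u v a : (0 <= a <= 1)%R ->
  measurable_fun [set: T] u -> measurable_fun [set: T] v ->
  (forall x, 0 <= u x) -> (forall x, 0 <= v x) ->
  \int[mu]_x (u x `^ a * v x `^ (1 - a)) <=
  (\int[mu]_x u x) `^ a * (\int[mu]_x v x) `^ (1 - a).
Proof.
move=> /andP[]; rewrite le_eqVlt => /predU1P[<- _ mu_ mv u0 v0|a0].
  rewrite subr0 poweRe0 mul1e poweRe1 ?integral_ge0//.
  under eq_integral do rewrite poweRe0 mul1e poweRe1//.
  by [].
rewrite le_eqVlt => /predU1P[-> mu_ mv u0 v0|a1 mu_ mv u0 v0].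
  rewrite subrr poweRe0 mule1 poweRe1 ?integral_ge0//.
  under eq_integral do rewrite poweRe0 mule1 poweRe1//.
  by [].
have b0 : (0 < 1 - a)%R by rewrite subr_gt0.
have iu0 : 0 <= \int[mu]_x u x by exact: integral_ge0.
have iv0 : 0 <= \int[mu]_x v x by exact: integral_ge0.
have m : measurable_fun [set: T] (fun x => u x `^ a * v x `^ (1 - a)).
  by apply: emeasurable_funM; exact: measurable_fun_poweR.
have uv0 x : 0 <= u x `^ a * v x `^ (1 - a) by rewrite mule_ge0 ?poweR_ge0.
(* A zero integral is treated before an infinite one: if one factor on the right is [0] and the
   other [+oo], the right side is [0], so the left side has to vanish too. *)
have z : (\int[mu]_x u x == 0) || (\int[mu]_x v x == 0) ->
    \int[mu]_x (u x `^ a * v x `^ (1 - a)) = 0.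
  move=> /orP h; rewrite -(integral0 mu setT).
  apply: ge0_ae_eq_integral => //.
  case: h => /eqP.
  - move=> /(ge0_integral_eq0_ae mu_ u0); apply: filterS => x -> _.
    by rewrite poweR0r ?gt_eqF// mul0e.
  - move=> /(ge0_integral_eq0_ae mv v0); apply: filterS => x -> _.
    by rewrite poweR0r ?gt_eqF// mule0.
have [/z -> |] := boolP ((\int[mu]_x u x == 0) || (\int[mu]_x v x == 0)).
  by rewrite mule_ge0 ?poweR_ge0.
rewrite negb_or => /andP[iu iv].
have iu_gt0 : 0 < \int[mu]_x u x by rewrite lt0e iu.
have iv_gt0 : 0 < \int[mu]_x v x by rewrite lt0e iv.
have [->|uoo] := eqVneq (\int[mu]_x u x) +oo.
  by rewrite poweRyr ?gt_eqF// gt0_mulye ?leey// poweR_gt0.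
have [->|voo] := eqVneq (\int[mu]_x v x) +oo.
  by rewrite poweRyr ?gt_eqF// gt0_muley ?leey// poweR_gt0.
have fin w : measurable_fun [set: T] w -> (forall x, 0 <= w x) ->
    \int[mu]_x w x != +oo -> {ae mu, forall x, w x \is a fin_num}.
  move=> mw w0 woo.
  have : mu.-integrable setT w.
    apply/integrableP; split => //.
    by under eq_integral do rewrite gee0_abs//; rewrite ltey.
  by move/(integrable_ae measurableT); apply: filterS => x; apply.
have := @hoelder_EFin (fine \o u) (fine \o v) a.
rewrite a0 a1 => /(_ isT).
have mfine w : measurable_fun [set: T] w -> measurable_fun [set: T] (fine \o w).
  by move=> mw; apply: measurableT_comp mw; exact: fine_measurable.
move=> /(_ (mfine _ mu_) (mfine _ mv)).
have fineE w : (forall x, 0 <= w x) -> \int[mu]_x w x != +oo ->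
    measurable_fun [set: T] w -> \int[mu]_x ((fine \o w) x)%:E = \int[mu]_x w x.
  move=> w0 woo mw; apply: ge0_ae_eq_integral => //.
  - by apply/measurable_EFinP; exact: mfine.
  - by move=> x _; rewrite lee_fin fine_ge0.
  - by apply: filterS (fin w mw w0 woo) => x wx _; rewrite fineK.
rewrite !fineE// => h; apply: le_trans (h _ _); last 2 first.
- by move=> x; exact: fine_ge0.
- by move=> x; exact: fine_ge0.
apply: ae_ge0_le_integral => //.
- by move=> x _; rewrite mule_ge0 ?poweR_ge0.
- by apply: emeasurable_funM; apply: measurable_fun_poweR;
    apply/measurable_EFinP; exact: mfine.
- apply: filterS2 (fin u mu_ u0 uoo) (fin v mv v0 voo) => x ux vx _.
  by rewrite /comp !fineK.
Qed.

Lemma hoelder3_ereal u v w a b c :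
  (0 <= a)%R -> (0 <= b)%R -> (0 <= c)%R -> (a + b + c = 1)%R ->
  measurable_fun [set: T] u -> measurable_fun [set: T] v ->
  measurable_fun [set: T] w ->
  (forall x, 0 <= u x) -> (forall x, 0 <= v x) -> (forall x, 0 <= w x) ->
  \int[mu]_x (u x `^ a * (v x `^ b * w x `^ c)) <=
  (\int[mu]_x u x) `^ a * ((\int[mu]_x v x) `^ b * (\int[mu]_x w x) `^ c).
Proof.
move=> a0 b0 c0 abc mu_ mv mw u0 v0 w0.
have [a1|a1] := eqVneq a 1%R.
  have -> : b = 0%R by lra.
  have -> : c = 0%R by lra.
  rewrite a1 !poweRe0 !mule1 poweRe1 ?integral_ge0//.
  by under eq_integral do rewrite !poweRe0 !mule1 poweRe1//.
(* Two-function Hölder is applied twice, with weights [a], [s] and then [b / s], [c / s], which sum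
   to 1 because [s = b + c]. *)
pose s := (1 - a)%R.
have s0 : (0 < s)%R by rewrite /s lt_neqAle eq_sym subr_eq0 eq_sym a1; lra.
have powK (x : \bar R) t : x `^ t = (x `^ (t / s)) `^ s.
  by rewrite -poweRrM divfK// gt_eqF.
have cE : (c / s = 1 - b / s)%R.
  by rewrite -[1%R](@divff _ s) ?gt_eqF// -mulrBl; congr (_ / _)%R; rewrite /s; lra.
have bs : (0 <= b / s <= 1)%R.
  by rewrite divr_ge0 ?(ltW s0)//= ler_pdivrMr// mul1r /s; lra.
under eq_integral do rewrite (powK _ b) (powK _ c) -poweRM ?poweR_ge0//.
apply: le_trans (hoelder2_ereal _ mu_ _ u0 _) _.
- by rewrite a0/=; lra.
- by apply: emeasurable_funM; exact: measurable_fun_poweR.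
- by move=> x; rewrite mule_ge0 ?poweR_ge0.
rewrite lee_wpmul2l ?poweR_ge0//.
rewrite (powK (\int[mu]_x v x)) (powK (\int[mu]_x w x)) -poweRM ?poweR_ge0//.
apply: lee_poweR; [exact: ltW| |].
  by apply: integral_ge0 => x _; rewrite mule_ge0 ?poweR_ge0.
by rewrite cE; exact: hoelder2_ereal.
Qed.
End hoelder.

(** No measurability is assumed: the integral of a nonnegative function is a supremum over the
    simple functions below it. [le_mixed_norm_rec] relies on this. *)
Lemma le_ge0_integral d (T : measurableType d) (R : realType)
    (mu : {measure set T -> \bar R}) (F G : T -> \bar R) :
  (forall x, 0 <= F x) -> (forall x, F x <= G x) ->
  \int[mu]_x F x <= \int[mu]_x G x.
Proof.
move=> F0 FG; have G0 x : 0 <= G x by apply: le_trans (FG x).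
rewrite !ge0_integralTE//; apply: ereal_sup_le => _ [h hF <-].
by exists h => // x; apply: le_trans (FG x).
Qed.

Section tonelli.
Context d1 d2 (T1 : measurableType d1) (T2 : measurableType d2) (R : realType).
Variable K : T1 * T2 -> \bar R.
Hypotheses (mK : measurable_fun [set: T1 * T2] K) (K0 : forall z, 0 <= K z).

Lemma measurable_integral_snd (m2 : {sigma_finite_measure set T2 -> \bar R}) :
  measurable_fun [set: T1] (fun x => \int[m2]_y K (x, y)).
Proof. exact: measurable_fun_fubini_tonelli_F. Qed.

Lemma measurable_integral_fst (m1 : {sigma_finite_measure set T1 -> \bar R}) :
  measurable_fun [set: T2] (fun y => \int[m1]_x K (x, y)).
Proof. exact: measurable_fun_fubini_tonelli_G. Qed.

End tonelli.

Section minkowski.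
Context d1 d2 (T1 : measurableType d1) (T2 : measurableType d2) (R : realType).
Variables (m1 : {sigma_finite_measure set T1 -> \bar R})
  (m2 : {sigma_finite_measure set T2 -> \bar R}).
Variables (K : T1 * T2 -> \bar R) (r : R).
Hypotheses (mK : measurable_fun [set: T1 * T2] K) (K0 : forall z, 0 <= K z).
Hypothesis (r1 : (1 <= r)%R).

Let k y := (\int[m1]_x K (x, y) `^ r) `^ r^-1.

Let r0 : (0 < r)%R. Proof. by rewrite (lt_le_trans _ r1). Qed.

Let mKr : measurable_fun [set: T1 * T2] (fun z => K z `^ r).
Proof. exact: measurable_fun_poweR. Qed.

Let k0 y : 0 <= k y. Proof. exact: poweR_ge0. Qed.

Let mk : measurable_fun [set: T2] k.
Proof.
apply: measurable_fun_poweR.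
apply: (@measurable_integral_fst _ _ _ _ _ (fun z => K z `^ r)) => // z.
exact: poweR_ge0.
Qed.

Let mk2 : measurable_fun [set: T1 * T2] (fun z => k z.2).
Proof. exact: measurableT_comp. Qed.

Let mK1 x : measurable_fun [set: T2] (fun y => K (x, y)).
Proof. exact: measurable_fun_pair2. Qed.

Let mK2 y : measurable_fun [set: T1] (fun x => K (x, y)).
Proof. exact: measurable_fun_pair1. Qed.

Let kr y : k y `^ r = \int[m1]_x K (x, y) `^ r.
Proof.
rewrite -poweRrM mulVf ?gt_eqF// poweRe1//.
by apply: integral_ge0 => x _; exact: poweR_ge0.
Qed.

(** If [k y = 0] then [K (x, y) = 0] for almost every [x]. Tonelli for [K ^ r] restricted to [k = 0]
    exchanges the order of the two quantifiers. The weight [W] carries no information where [k]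
    vanishes, so this set has to be handled separately. *)
Let vanish : {ae m1, forall x, {ae m2, forall y, k y = 0 -> K (x, y) = 0}}.
Proof.
pose S := k @^-1` [set 0].
have mS : measurable S by rewrite -[S]setTI; exact: mk.
pose f z := K z `^ r * (\1_S z.2)%:E.
have f0 z : 0 <= f z by rewrite mule_ge0 ?poweR_ge0// lee_fin.
have mf : measurable_fun [set: T1 * T2] f.
  apply: emeasurable_funM => //; apply/measurable_EFinP.
  exact: measurableT_comp.
have : \int[m1]_x \int[m2]_y f (x, y) = 0.
  rewrite fubini_tonelli//= -(integral0 m2 setT); apply: eq_integral => y _ /=.
under eq_integral do rewrite /f/=.
  rewrite ge0_integralZr//; last 2 first.
  - exact: measurable_fun_poweR.
  - by move=> x _; exact: poweR_ge0.
  rewrite -kr indicE; have [|] := boolP (y \in S); last by rewrite mule0.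
  by rewrite inE => ->; rewrite mule1 poweR0r ?gt_eqF.
move/(@ge0_integral_eq0_ae _ T1 R m1) => h.
apply: filterS (h _ _) => [x||x]; last 2 first.
- exact: measurable_integral_snd.
- exact: integral_ge0.
move=> /(@ge0_integral_eq0_ae _ T2 R m2) {}h.
apply: filterS (h _ _) => [y|//|//]; last exact: measurable_fun_pair2.
rewrite /f/= indicE => + ky; rewrite mem_set// mule1.
exact: poweR_eq0_eq0.
Qed.

(* Hölder's inequality in [y] is applied to [K = W `^ r^-1 * k `^ (1 - r^-1)], where
   [k] is the [L^r] norm in [x]: the integral of [W] in [x] is again [k], so no
   norm that could be infinite has to be divided out. *)
Let W z := K z `^ r * k z.2 `^ (1 - r).

Let W0 z : 0 <= W z. Proof. by rewrite mule_ge0 ?poweR_ge0. Qed.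

Let mW : measurable_fun [set: T1 * T2] W.
Proof. by apply: emeasurable_funM => //; exact: measurable_fun_poweR. Qed.

(* Where [0 < k < +oo] this is an equality; the case [k = +oo] uses that
   [+oo `^ s = +oo] also for [s < 0]. *)
Let K_le_weighted x y : (k y = 0 -> K (x, y) = 0) ->
  K (x, y) <= W (x, y) `^ r^-1 * k y `^ (1 - r^-1).
Proof.
have rV : (0 < r^-1)%R by rewrite invr_gt0.
rewrite /W/=; move: (k y) (k0 y) => t t0.
rewrite poweRM ?poweR_ge0// -!poweRrM divff ?gt_eqF// poweRe1// -muleA.
have [ty /(_ ty)->|ty _] := eqVneq t 0.
  by rewrite mul0e.
have -> : ((1 - r) / r = r^-1 - 1)%R by rewrite mulrBl mul1r divff ?gt_eqF.
have [r_eq1|r_neq1] := eqVneq r 1%R.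
  by rewrite r_eq1 invr1 subrr !poweRe0 !mule1.
have rV1 : (r^-1 != 1)%R by rewrite invr_eq1.
have [->|tfin] := eqVneq t +oo.
  rewrite !poweRyr ?subr_eq0// 1?eq_sym// mulyy.
  have [->|K_neq0] := eqVneq (K (x, y)) 0; first by rewrite mul0e.
  by rewrite gt0_muley ?leey// lt0e K_neq0 K0.
have {}tfin : t \is a fin_num by rewrite ge0_fin_numE// ltey.
rewrite -poweRD.
  by rewrite (_ : r^-1 - 1 + (1 - r^-1) = 0)%R ?poweRe0 ?mule1//; ring.
by rewrite /poweRD_def ty tfin/= implybT.
Qed.

Lemma minkowski_integral :
  \int[m1]_x (\int[m2]_y K (x, y)) `^ r <=
  (\int[m2]_y (\int[m1]_x K (x, y) `^ r) `^ r^-1) `^ r.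
Proof.
rewrite -/(k _); under [in leRHS]eq_integral do rewrite -/(k _).
set J := \int[m2]_y k y.
have J0 : 0 <= J by exact: integral_ge0.
have mWx : measurable_fun [set: T1] (fun x => \int[m2]_y W (x, y)).
  exact: measurable_integral_snd.
have rV : (0 <= r^-1 <= 1)%R by rewrite invr_ge0 (ltW r0)/= invf_le1.
(* Hölder in [y] leaves a factor [J ^ (1 - r^-1)], whose [r]-th power is [J ^ (r - 1)]. By Tonelli
   the double integral of [W] is [J], so the bound becomes [J ^ r]. *)
apply: (@le_trans _ _ (\int[m1]_x ((\int[m2]_y W (x, y)) * J `^ (r - 1)))).
  apply: ae_ge0_le_integral => //.
  - by move=> x _; exact: poweR_ge0.
  - apply: measurable_fun_poweR.
    exact: measurable_integral_snd.
  - by move=> x _; rewrite mule_ge0 ?poweR_ge0// integral_ge0.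
  - by apply: emeasurable_funM.
  apply: filterS vanish => x Kx _.
  have -> : (\int[m2]_y W (x, y)) * J `^ (r - 1) =
      ((\int[m2]_y W (x, y)) `^ r^-1 * J `^ (1 - r^-1)) `^ r.
    rewrite poweRM ?poweR_ge0// -!poweRrM mulVf ?gt_eqF// poweRe1 ?integral_ge0//.
    by rewrite mulrBl mul1r mulVf ?gt_eqF.
  apply: lee_poweR; [exact: ltW|exact: integral_ge0|].
  have mWxy : measurable_fun [set: T2] (fun y => W (x, y)).
    exact: measurable_fun_pair2.
  apply: le_trans (@hoelder2_ereal _ _ _ m2 _ k _ rV mWxy mk _ k0) => //.
  apply: ae_ge0_le_integral => //.
  - by move=> y _; rewrite mule_ge0 ?poweR_ge0.
  - by apply: emeasurable_funM; apply: measurable_fun_poweR.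
  - by apply: filterS Kx => y Kxy _; exact: K_le_weighted.
rewrite ge0_integralZr//; last 2 first.
- by move=> x _; exact: integral_ge0.
- exact: poweR_ge0.
have -> : \int[m1]_x \int[m2]_y W (x, y) = J.
  rewrite fubini_tonelli//; apply: eq_integral => y _.
  rewrite /W/= ge0_integralZr ?poweR_ge0//; last 2 first.
  - exact: measurable_fun_poweR.
  - by move=> x _; exact: poweR_ge0.
  (* Adding exponents can fail at [0] or [+oo] only when they cancel; here their sum is 1. *)
  rewrite -kr -poweRD; first by rewrite addrC subrK poweRe1.
  by apply: add_neq0_poweRD_def; rewrite addrC subrK.
rewrite -{1}(poweRe1 J0) -poweRD; first by rewrite addrC subrK.
by apply: add_neq0_poweRD_def; rewrite addrC subrK gt_eqF.
Qed.
End minkowski.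

(** * Young's inequality on the line *)

Section lebesgue_invariance.
Variable R : realType.
Local Notation leb := (@lebesgue_measure R).

Lemma lebesgue_measure_shift (s : R) (A : set R) : measurable A ->
  pushforward leb ((fun x => x - s)%R : _ -> measurableTypeR R) A = leb A.
Proof.
move=> mA; apply/esym/lebesgue_measure_unique => //=.
  by apply: measurable_funB.
move=> mphi _ [[a b]] _ <-; rewrite /pushforward.
rewrite (_ : _ @^-1` _ = `](a + s)%R, (b + s)%R]%classic); last first.
  by apply/seteqP; split => x /=; rewrite !in_itv/= => /andP[? ?];
    apply/andP; split; lra.
rewrite !lebesgue_measure_itv/= !lte_fin ltrD2r; case: ifPn => // _.
by rewrite -!EFinB; congr EFin; lra.
Qed.

Lemma lebesgue_measure_reflect (s : R) (A : set R) : measurable A ->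
  pushforward leb ((fun x => s - x)%R : _ -> measurableTypeR R) A = leb A.
Proof.
move=> mA; apply/esym/lebesgue_measure_unique => //=.
  by apply: measurable_funB.
move=> mphi _ [[a b]] _ <-; rewrite /pushforward.
(* Reflection swaps the open and the closed end, which leaves the length unchanged. *)
rewrite (_ : _ @^-1` _ = `[(s - b)%R, (s - a)%R[%classic); last first.
  by apply/seteqP; split => x /=; rewrite !in_itv/= => /andP[? ?];
    apply/andP; split; lra.
rewrite !lebesgue_measure_itv/= !lte_fin ltrD2l ltrN2; case: ifPn => // _.
by rewrite -!EFinB; congr EFin; lra.
Qed.

Variable F : measurableTypeR R -> \bar R.
Hypotheses (mF : measurable_fun [set: measurableTypeR R] F) (F0 : forall x, 0 <= F x).

Lemma ge0_integral_shift s : \int[leb]_x F (x - s)%R = \int[leb]_x F x.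
Proof.
pose phi := (fun x => x - s)%R : measurableTypeR R -> measurableTypeR R.
have mphi : measurable_fun [set: measurableTypeR R] phi by exact: measurable_funB.
transitivity (\int[pushforward leb phi]_x F x).
  by rewrite (ge0_integral_pushforward mphi).
by apply: eq_measure_integral => //= A mA _; exact: lebesgue_measure_shift.
Qed.

Lemma ge0_integral_reflect s : \int[leb]_x F (s - x)%R = \int[leb]_x F x.
Proof.
pose phi := (fun x => s - x)%R : measurableTypeR R -> measurableTypeR R.
have mphi : measurable_fun [set: measurableTypeR R] phi by exact: measurable_funB.
transitivity (\int[pushforward leb phi]_x F x).
  by rewrite (ge0_integral_pushforward mphi).
by apply: eq_measure_integral => //= A mA _; exact: lebesgue_measure_reflect.
Qed.
End lebesgue_invariance.

Section young1.
Variable R : realType.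
Local Notation leb := (@lebesgue_measure R).
Local Notation RR := (measurableTypeR R).
Variables (F G : RR -> \bar R).
Hypotheses (mF : measurable_fun [set: RR] F) (F0 : forall x, 0 <= F x).
Hypotheses (mG : measurable_fun [set: RR] G) (G0 : forall x, 0 <= G x).

Lemma young_convolution1 (p q r : R) :
  (1 <= p)%R -> (1 <= q)%R -> (1 <= r)%R -> (p^-1 + q^-1 = r^-1 + 1)%R ->
  (\int[leb]_x (\int[leb]_s (F (x - s)%R * G s)) `^ r) `^ r^-1 <=
  (\int[leb]_x F x `^ p) `^ p^-1 * (\int[leb]_x G x `^ q) `^ q^-1.
Proof.
move=> p1 q1 r1 pqr.
have p0 : (0 < p)%R by rewrite (lt_le_trans _ p1).
have q0 : (0 < q)%R by rewrite (lt_le_trans _ q1).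
have r0 : (0 < r)%R by rewrite (lt_le_trans _ r1).
have pV : (p^-1 <= 1)%R by rewrite invf_le1.
have qV : (q^-1 <= 1)%R by rewrite invf_le1.
have rV : (0 < r^-1)%R by rewrite invr_gt0.
set A := \int[leb]_x F x `^ p; set B := \int[leb]_x G x `^ q.
have A0 : 0 <= A by apply: integral_ge0 => x _; exact: poweR_ge0.
have B0 : 0 <= B by apply: integral_ge0 => x _; exact: poweR_ge0.
(* Splitting [F * G] as [U ^ r^-1 * (F ^ p) ^ b * (G ^ q) ^ c] forces [p / r + p * b = 1] and
   [q / r + q * c = 1], that is [b = p^-1 - r^-1] and [c = q^-1 - r^-1]. The relation between the
   exponents turns these into the values below and makes the three weights sum to 1. *)
pose b := (1 - q^-1)%R; pose c := (1 - p^-1)%R.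
have b0 : (0 <= b)%R by rewrite subr_ge0.
have c0 : (0 <= c)%R by rewrite subr_ge0.
have abc : (r^-1 + b + c = 1)%R by rewrite /b /c; lra.
have mFp : measurable_fun [set: RR] (fun x => F x `^ p).
  exact: measurable_fun_poweR.
have mGq : measurable_fun [set: RR] (fun x => G x `^ q).
  exact: measurable_fun_poweR.
pose U (z : RR * RR) := F (z.1 - z.2)%R `^ p * G z.2 `^ q.
have U0 z : 0 <= U z by rewrite mule_ge0 ?poweR_ge0.
have mU : measurable_fun [set: RR * RR] U.
  apply: emeasurable_funM.
  - apply: (measurableT_comp mFp (g := fun z : RR * RR => (z.1 - z.2)%R)).
    exact: measurable_funB.
  - exact: (measurableT_comp mGq).
have split x s : F (x - s)%R * G s =
    U (x, s) `^ r^-1 * (F (x - s)%R `^ p `^ b * G s `^ q `^ c).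
  rewrite /U/= poweRM ?poweR_ge0// -!poweRrM muleACA.
  have e1 : (p / r + p * b = 1)%R.
    by rewrite -mulrDr (_ : r^-1 + b = p^-1)%R ?divff ?gt_eqF// /b; lra.
  have e2 : (q / r + q * c = 1)%R.
    by rewrite -mulrDr (_ : r^-1 + c = q^-1)%R ?divff ?gt_eqF// /c; lra.
  rewrite -!poweRD ?e1 ?e2 ?poweRe1//.
  - by apply: add_neq0_poweRD_def; rewrite e2.
  - by apply: add_neq0_poweRD_def; rewrite e1.
have bound x : (\int[leb]_s (F (x - s)%R * G s)) `^ r <=
    (\int[leb]_s U (x, s)) * (A `^ (b * r) * B `^ (c * r)).
  have -> : (\int[leb]_s U (x, s)) * (A `^ (b * r) * B `^ (c * r)) =
      ((\int[leb]_s U (x, s)) `^ r^-1 * (A `^ b * B `^ c)) `^ r.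
    rewrite !poweRM ?mule_ge0 ?poweR_ge0// -!poweRrM mulVf ?gt_eqF//.
    by rewrite poweRe1// integral_ge0.
  apply: lee_poweR; [exact: ltW| |].
    by apply: integral_ge0 => s _; rewrite mule_ge0.
  under eq_integral do rewrite split.
  have <- : \int[leb]_s F (x - s)%R `^ p = A.
    by apply: (ge0_integral_reflect mFp) => s; exact: poweR_ge0.
  apply: (@hoelder3_ereal _ _ _ leb (fun s => U (x, s))
    (fun s => F (x - s)%R `^ p) (fun s => G s `^ q)) => //.
  - exact: ltW.
  - exact: measurable_fun_pair2.
  - apply: (measurableT_comp mFp (g := fun s : RR => (x - s)%R)).
    exact: measurable_funB.
  - by move=> s; exact: poweR_ge0.
  - by move=> s; exact: poweR_ge0.
have intU : \int[leb]_x \int[leb]_s U (x, s) = A * B.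
  rewrite fubini_tonelli// /U/=.
  under eq_integral.
    move=> s _; rewrite ge0_integralZr ?poweR_ge0//; last 2 first.
    - apply: (measurableT_comp mFp (g := fun x : RR => (x - s)%R)).
      exact: measurable_funB.
    - by move=> x _; exact: poweR_ge0.
    rewrite (ge0_integral_shift mFp); last by move=> ?; exact: poweR_ge0.
    over.
  by rewrite ge0_integralZl// => s _; exact: poweR_ge0.
(* [A] and [B] may be [0] or [+oo]; their powers still combine because the total exponents [r / p]
   and [r / q] are nonzero. *)
have -> : A `^ p^-1 * B `^ q^-1 =
    ((A * B) * (A `^ (b * r) * B `^ (c * r))) `^ r^-1.
  rewrite muleACA -{2}(poweRe1 A0) -{2}(poweRe1 B0).
  have e1 : (1 + b * r = r / p)%R.
    by rewrite /b (_ : 1 - q^-1 = p^-1 - r^-1)%R; [field; rewrite !gt_eqF|lra].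
  have e2 : (1 + c * r = r / q)%R.
    by rewrite /c (_ : 1 - p^-1 = q^-1 - r^-1)%R; [field; rewrite !gt_eqF|lra].
  rewrite -!poweRD ?e1 ?e2; last 2 first.
  - by apply: add_neq0_poweRD_def; rewrite e2 mulf_neq0 ?invr_neq0 ?gt_eqF.
  - by apply: add_neq0_poweRD_def; rewrite e1 mulf_neq0 ?invr_neq0 ?gt_eqF.
  rewrite poweRM ?poweR_ge0// -!poweRrM.
  by rewrite (mulrAC r p^-1%R) (mulrAC r q^-1%R) divff ?gt_eqF// !mul1r.
apply: lee_poweR; [exact: ltW| |].
  by apply: integral_ge0 => x _; exact: poweR_ge0.
apply: (@le_trans _ _ (\int[leb]_x
    ((\int[leb]_s U (x, s)) * (A `^ (b * r) * B `^ (c * r))))).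
  by apply: le_ge0_integral => x; [exact: poweR_ge0|exact: bound].
rewrite ge0_integralZr ?intU//.
- exact: measurable_integral_snd.
- by move=> x _; exact: integral_ge0.
- by rewrite mule_ge0 ?poweR_ge0.
Qed.
End young1.

(** * Null sets and completion *)

Section null_sets.
Context d (T : measurableType d) (R : realType).
Variables (mu : {measure set T -> \bar R}) (N : set T).
Hypotheses (mN : measurable N) (N0 : mu N = 0).

(** A simple function below [F], set to [0] on [N], is a simple function below [G] with the same
    integral. *)
Let le_integral_off_null (F G : T -> \bar R) :
  (forall x, 0 <= F x) -> (forall x, 0 <= G x) -> (forall x, ~ N x -> F x = G x) ->
  \int[mu]_x F x <= \int[mu]_x G x.
Proof.
move=> F0 G0 FG; rewrite !ge0_integralTE//; apply: ge_ereal_sup => _ [h hF <-].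
have mNc : measurable (~` N) by exact: measurableC.
apply: le_ereal_sup_tmp; exists (sintegral mu (proj_nnsfun h mNc)).
  exists (proj_nnsfun h mNc) => // x; rewrite /= mindicE.
  have [|] := boolP (x \in ~` N); last by rewrite mulr0.
  by rewrite inE => Nx; rewrite mulr1 -FG.
rewrite -!integralT_nnsfun le_eqVlt; apply/orP; left; apply/eqP.
apply: ge0_ae_eq_integral => //.
- exact/measurable_EFinP.
- exact/measurable_EFinP.
- by move=> x _; rewrite lee_fin.
- by move=> x _; rewrite lee_fin.
exists N; split => // x /= /not_implyP[_]; apply: contra_notP => Nx.
by rewrite mindicE mem_set// mulr1.
Qed.

(* Neither function is assumed measurable: the library integral of a nonnegative
   function is its lower integral. *)
Lemma eq_integral_off_null (F G : T -> \bar R) :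
  (forall x, 0 <= F x) -> (forall x, 0 <= G x) -> (forall x, ~ N x -> F x = G x) ->
  \int[mu]_x F x = \int[mu]_x G x.
Proof.
move=> F0 G0 FG; apply/eqP; rewrite eq_le !le_integral_off_null// => x Nx.
by rewrite FG.
Qed.
End null_sets.

Section caratheodory_completion.
Context d (T : measurableType d) (R : realType).
Variable mu : {sigma_finite_measure set T -> \bar R}.

Let mu_extE (X : set T) : measurable X -> (mu^*)%mu X = mu X.
Proof. exact: measurable_mu_extE. Qed.

Let measure_bigcup_null (N : (set T)^nat) : (forall n, measurable (N n)) ->
  (forall n, mu (N n) = 0) -> mu (\bigcup_n N n) = 0.
Proof.
move=> mN N0; apply/negligibleP; first exact: bigcupT_measurable.
apply: negligible_bigcup => n. exists (N n). split; [exact: mN|exact: N0|by []]. 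
Qed.

(** The hull is the intersection of measurable covers of [X] that exceed its outer measure by at
    most [1 / (n + 1)]. *)
Lemma measurable_hull (X : set T) :
  exists F, [/\ measurable F, X `<=` F & mu F = (mu^*)%mu X].
Proof.
have [Xoo|Xoo] := eqVneq ((mu^*)%mu X) +oo.
  exists setT; split => //; rewrite Xoo; apply/eqP; rewrite -leye_eq -Xoo.
  by rewrite -(mu_extE measurableT) le_mu_ext.
have Xfin : (mu^*)%mu X \is a fin_num.
  by rewrite ge0_fin_numE ?ltey// outer_measure_ge0.
have cover n : exists A : (set T)^nat, [/\ forall k, measurable (A k),
    X `<=` \bigcup_k A k & mu (\bigcup_k A k) <= (mu^*)%mu X + n.+1%:R^-1%:E].
  have n0 : (0 < n.+1%:R^-1 :> R)%R by rewrite invr_gt0.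
  have [_ [A [mA XA] <-] /ltW leA] := lb_ereal_inf_adherent n0 Xfin.
  exists A; split => //; apply: le_trans leA.
  by apply: measure_sigma_subadditive => //; exact: bigcupT_measurable.
have [A /all_and3[mA XA leA]] := choice cover.
have mU n : measurable (\bigcup_k A n k) by exact: bigcupT_measurable.
have mF : measurable (\bigcap_n \bigcup_k A n k) by exact: bigcapT_measurable.
exists (\bigcap_n \bigcup_k A n k); split => //.
  by move=> x Xx n _; exact: XA.
apply/eqP; rewrite eq_le; apply/andP; split; last first.
  rewrite -(mu_extE mF); apply: le_mu_ext => x Xx n _.
  exact: XA.
apply/lee_addgt0Pr => _/posnumP[e].
near \oo => n; apply: (@le_trans _ _ (mu (\bigcup_k A n k))).
  by apply: le_measure; rewrite ?inE//; exact: bigcap_inf.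
rewrite (le_trans (leA n))// leeD// lee_fin ltW//.
by near: n; exact: near_infty_natSinv_lt.
Unshelve. all: by end_near. Qed.

(** On a piece of finite measure, let [F] be a hull of [En]. Carathéodory's condition splits [mu F]
    into the outer measures of [En] and of the excess of [F] over [En]. The first is finite and
    equals [mu F], so the excess is null, and so is its own hull [N]. Sigma-finiteness glues the
    pieces. *)
Lemma caratheodory_eq_off_null (E : set T) : (mu^*)%mu.-cara.-measurable E ->
  exists B N, [/\ measurable B, measurable N, mu N = 0 &
    forall x, ~ N x -> (E x <-> B x)].
Proof.
move=> mE; have /sigma_finiteP[S [TS ndS mS]] := sigma_finiteT mu.
have piece n : exists BN : set T * set T, [/\ measurable BN.1, measurable BN.2,
    mu BN.2 = 0 & forall x, ~ BN.2 x -> (E x /\ S n x <-> BN.1 x)].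
  have [mSn Sn_lty] := mS n; have Sn_fin : mu (S n) < +oo := Sn_lty.
  pose En := E `&` S n.
  have mEn : (mu^*)%mu.-cara.-measurable En.
    by apply: measurableI => //; exact: caratheodory_measurable_mu_ext.
  have [F [mF EF FE]] := measurable_hull En.
  have [N [mN DN NE]] := measurable_hull (F `\` En).
  exists (F, N); split => //=.
    rewrite NE.
    have : (mu^*)%mu F = (mu^*)%mu (F `&` En) + (mu^*)%mu (F `&` ~` En).
      exact: mEn.
    rewrite (setIidr EF) -setDE.
    rewrite (mu_extE mF). rewrite FE => e.
    have Efin : (mu^*)%mu En \is a fin_num.
      rewrite ge0_fin_numE ?outer_measure_ge0// (le_lt_trans _ Sn_fin)//.
      by rewrite -(mu_extE mSn); apply: le_mu_ext => x [].
    move: e Efin; move: ((mu^*)%mu En) ((mu^*)%mu (F `\` En)).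
    by move=> [a| |] [b| |]//= [ab] _; congr EFin; lra.
  move=> x Nx; split => [Ex|Fx]; first exact: EF.
  by apply: contrapT => Ex; apply: Nx; apply: DN; split.
have [BN /all_and4[mB mN N0 BE]] := choice piece.
exists (\bigcup_n (BN n).1), (\bigcup_n (BN n).2); split.
- exact: bigcupT_measurable.
- exact: bigcupT_measurable.
- exact: measure_bigcup_null.
move=> x Nx.
have Nn n : ~ (BN n).2 x by move=> ?; apply: Nx; exists n.
split => [Ex|[n _ /BE -/(_ (Nn n))[]//]].
have : [set: T] x by [].
by rewrite TS => -[n _ Sx]; exists n => //; apply/(BE n).
Qed.

Lemma caratheodory_fun_eq_off_null (f : T -> R) :
  measurable_fun [set: caratheodory_type (mu^*)%mu] f ->
  exists g N, [/\ measurable_fun [set: T] g, measurable N, mu N = 0 &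
    forall x, ~ N x -> f x = g x].
Proof.
(* [q] enumerates the rationals. Codes of no rational give the value 0, which only repeats a
   level. *)
move=> mf; pose q n : R := ratr (odflt 0%R (unpickle n)).
have piece n : exists BN : set T * set T, [/\ measurable BN.1, measurable BN.2,
    mu BN.2 = 0 & forall x, ~ BN.2 x -> ((q n < f x)%R <-> BN.1 x)].
  have : (mu^*)%mu.-cara.-measurable (f @^-1` `]q n, +oo[).
    by rewrite -[X in _ X]setTI; exact: mf.
  move=> /caratheodory_eq_off_null[B [N [mB mN N0 BE]]].
  by exists (B, N); split => //= x /BE /=; rewrite in_itv/= andbT.
have [BN /all_and4[mB mN N0 BE]] := choice piece.
pose N := \bigcup_n (BN n).2.
have mNN : measurable N by exact: bigcupT_measurable.
exists (fun x => if x \in N then 0%R else f x), N; split => //.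
- apply: (measurability _ (RGenOInfty.measurableE R)) => _ [_ [a ->] <-].
  rewrite setTI.
  (* On [N] the new function is 0, so [N] lies in the preimage exactly when [a < 0], that is, when
     some rational lies strictly between [a] and 0. *)
  have -> : (fun x => if x \in N then 0%R else f x) @^-1` `]a, +oo[ =
      \bigcup_n (if (a < q n)%R then
        (BN n).1 `\` N `|` (if (q n < 0)%R then N else set0) else set0).
    apply/seteqP; split => [x/=|x [n _]].
      rewrite in_itv/= andbT => ax.
      have [r] := rat_in_itvoo ax; rewrite in_itv/= => /andP[ar rx].
      exists (pickle r) => //; rewrite /q pickleK/= ar.
      move: rx; case: ifPn => [|]; rewrite ?inE ?notin_setE => Nx rx.
        by right; rewrite rx.
      left; split => //; apply/(BE (pickle r)).
        by move=> ?; apply: Nx; exists (pickle r).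
      by rewrite /q pickleK.
    case: ifPn => // aq [[Bx Nx]|]/=.
      rewrite memNset// in_itv/= andbT (lt_trans aq)//; apply/(BE n) => //.
      by move=> ?; apply: Nx; exists n.
    by case: ifPn => // q0 Nx; rewrite mem_set// in_itv/= andbT (lt_trans aq).
  apply: bigcupT_measurable => n; case: ifPn => // _.
  by apply: measurableU; [exact: measurableD|case: ifPn].
- exact: measure_bigcup_null.
- by move=> x Nx; rewrite memNset.
Qed.
End caratheodory_completion.

(** * Iterated integrals over R^n *)

Section completed_integral.
Variable R : realType.

(** The identity from the completed sigma-algebra to the Borel one is measurable and pushes the
    completed measure forward to Lebesgue measure. *)
Lemma integral_completed_lebesgue (F : measurableTypeR R -> \bar R) :
  measurable_fun [set: measurableTypeR R] F -> (forall s, 0 <= F s) ->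
  \int[completed_lebesgue_measure]_s F s = \int[lebesgue_measure]_s F s.
Proof.
move=> mF F0.
pose C := caratheodory_type (@wlength R idfun)^*%mu.
pose i : C -> measurableTypeR R := id.
have mi : measurable_fun [set: C] i.
  by move=> _ A mA; rewrite setTI; exact: sub_caratheodory.
have := @ge0_integral_pushforward _ _ _ _ _ i mi (@completed_lebesgue_measure R)
  setT F measurableT mF (fun s _ => F0 s).
by rewrite preimage_setT => <-; exact: eq_measure_integral.
Qed.

Lemma lebesgue_Rn_measurable n (A : set (borelRn R n)) :
  measurable A -> measurable (A : set (lebesgueRn R n)).
Proof. exact: caratheodory_measurable_mu_ext. Qed.

Lemma lebesgue_RnE n (A : set (borelRn R n)) :
  measurable A -> @lebesgue_Rn R n A = borel_lebesgue R n A.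
Proof. exact: measurable_mu_extE. Qed.

Lemma measurable_fun_lebesgueRn d (T : measurableType d) n (F : borelRn R n -> T) :
  measurable_fun [set: borelRn R n] F -> measurable_fun [set: lebesgueRn R n] F.
Proof.
move=> mF _ Y mY; apply: lebesgue_Rn_measurable.
exact: mF.
Qed.

Lemma integral_lebesgue_Rn n (F : borelRn R n -> \bar R) :
  measurable_fun [set: borelRn R n] F -> (forall t, 0 <= F t) ->
  \int[@lebesgue_Rn R n]_t F t = \int[borel_lebesgue R n]_t F t.
Proof.
move=> mF F0.
pose i : lebesgueRn R n -> borelRn R n := id.
have mi : measurable_fun [set: lebesgueRn R n] i.
  by move=> _ A mA; rewrite setTI; exact: lebesgue_Rn_measurable.
have := @ge0_integral_pushforward _ _ _ _ _ i mi (@lebesgue_Rn R n)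
  setT F measurableT mF (fun s _ => F0 s).
rewrite preimage_setT => <-; apply: eq_measure_integral => A mA _.
exact: lebesgue_RnE.
Qed.

End completed_integral.

Section iterated_integral.
Variables (R : realType) (n : nat).
Local Notation leb := (@lebesgue_measure R).
Local Notation RR := (measurableTypeR R).

Lemma measurable_fun_tcons (F : borelRn R n.+1 -> \bar R) :
  measurable_fun [set: borelRn R n.+1] F ->
  measurable_fun [set: RR * borelRn R n] (fun z => F [tuple of z.1 :: z.2]).
Proof. by move=> mF; exact: (measurableT_comp mF (@measurable_tcons R n)). Qed.

Lemma integral_borel_lebesgueS (F : borelRn R n.+1 -> \bar R) :
  measurable_fun [set: borelRn R n.+1] F -> (forall t, 0 <= F t) ->
  \int[borel_lebesgue R n.+1]_t F t =
  \int[borel_lebesgue R n]_t \int[leb]_s F [tuple of s :: t].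
Proof.
move=> mF F0.
transitivity (\int[leb \x borel_lebesgue R n]_z F (tcons z)).
  have := @ge0_integral_pushforward _ _ _ _ _ _ (@measurable_tcons R n)
    (leb \x borel_lebesgue R n) setT F measurableT mF (fun t _ => F0 t).
  by rewrite preimage_setT.
have mFc := measurable_fun_tcons mF.
exact: (@fubini_tonelli2 _ _ _ _ _ leb (borel_lebesgue R n) _ mFc (fun z => F0 _)).
Qed.

(** By Tonelli for the indicator of [N], the measure of the section at [t] integrates to 0 in
    [t]. *)
Lemma null_section (N : set (borelRn R n.+1)) :
  measurable N -> borel_lebesgue R n.+1 N = 0 ->
  exists M, [/\ measurable M, borel_lebesgue R n M = 0 & forall t, ~ M t ->
    let S := [set s : RR | N [tuple of s :: t]] in measurable S /\ leb S = 0].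
Proof.
move=> mN N0.
pose F t : \bar R := (\1_N t)%:E.
have F0 t : 0 <= F t by rewrite lee_fin.
have mF : measurable_fun [set: borelRn R n.+1] F by exact/measurable_EFinP.
have : \int[borel_lebesgue R n]_t \int[leb]_s F [tuple of s :: t] = 0.
  by rewrite -integral_borel_lebesgueS// integral_indic// setIT; exact: N0.
move/(@ge0_integral_eq0_ae _ _ R (borel_lebesgue R n)) => [||M [mM M0 sM]].
- exact: (measurable_integral_fst (measurable_fun_tcons mF)).
- by move=> t; exact: integral_ge0.
exists M; split => // t Mt S.
have mS : measurable S.
  rewrite (_ : S = (fun s => tcons (s, t)) @^-1` N)// -[X in measurable X]setTI.
  by apply: (measurable_fun_pair1 _ (@measurable_tcons R n)) => //.
split => //.
have : \int[leb]_s F [tuple of s :: t] = 0.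
  by apply: contrapT => Ft; apply: Mt; apply: sM.
by rewrite (_ : (fun _ => _) = EFin \o \1_S)// integral_indic// setIT.
Qed.

End iterated_integral.

(** * Mixed norms *)

Section mixed_norm_rec.
Variable R : realType.
Local Notation leb := (@lebesgue_measure R).
Local Notation RR := (measurableTypeR R).

Lemma mixed_norm_rec_off_null n (p0 : R) (p : n.-tuple R)
    (F G : borelRn R n -> \bar R) (N : set (borelRn R n)) :
  measurable N -> borel_lebesgue R n N = 0 ->
  (forall t, 0 <= F t) -> (forall t, 0 <= G t) -> (forall t, ~ N t -> F t = G t) ->
  mixed_norm_rec p0 p F = mixed_norm_rec p0 p G.
Proof.
elim: n p0 p F G N => [|n IH] p0 p F G N mN N0 F0 G0 FG /=.
  (* In dimension 0 the measure is a Dirac mass, so a null set misses the only point. *)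
  congr (_ `^ _); apply: FG => Nt; move: N0.
  rewrite (_ : borel_lebesgue R 0 N = \d_([tuple] : borelRn R 0) N)// diracE.
  by rewrite mem_set// => /eqP; rewrite onee_eq0.
have [M [mM M0 sM]] := null_section mN N0.
apply: (IH _ _ _ _ M mM M0) => [t|t|t Mt].
- by apply: integral_ge0 => s _; exact: poweR_ge0.
- by apply: integral_ge0 => s _; exact: poweR_ge0.
have [mS S0] := sM t Mt.
apply: (@eq_integral_off_null _ _ R completed_lebesgue_measure
  [set s : RR | N [tuple of s :: t]]) => [||s|s|s Ns].
- exact: sub_caratheodory.
- exact: S0.
- exact: poweR_ge0.
- exact: poweR_ge0.
- by rewrite FG.
Qed.

(** Absorbing [p0] into the function restores [p0 = 1], the form in which the induction for Young's
    inequality is stated. *)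
Lemma mixed_norm_recE n (p0 : R) (p : n.-tuple R) (F : borelRn R n -> \bar R) :
  mixed_norm_rec p0 p F = mixed_norm_rec 1%R p (fun t => F t `^ p0^-1).
Proof.
case: n p F => [|n] p F /=; first by rewrite -poweRrM invr1 mulr1.
congr (mixed_norm_rec _ _ _); apply/funext => t; apply: eq_integral => s _.
by rewrite -poweRrM divr1 mulrC.
Qed.

Lemma mixed_norm_rec_cons n (p : n.+1.-tuple R) (F : borelRn R n.+1 -> \bar R) :
  measurable_fun [set: borelRn R n.+1] F ->
  mixed_norm_rec 1%R p F = mixed_norm_rec 1%R [tuple of behead p]
    (fun t => (\int[leb]_s F [tuple of s :: t] `^ thead p) `^ (thead p)^-1).
Proof.
move=> mF; rewrite /= mixed_norm_recE.
congr (mixed_norm_rec _ _ _); apply/funext => t; congr (_ `^ _).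
rewrite divr1 integral_completed_lebesgue//; last by move=> s; exact: poweR_ge0.
apply: measurable_fun_poweR.
exact: (measurable_fun_pair1 _ (measurable_fun_tcons mF)).
Qed.

Lemma measurable_norm_head n (p : R) (F : borelRn R n.+1 -> \bar R) :
  measurable_fun [set: borelRn R n.+1] F ->
  measurable_fun [set: borelRn R n]
    (fun t => (\int[leb]_s F [tuple of s :: t] `^ p) `^ p^-1).
Proof.
move=> mF; apply: measurable_fun_poweR.
pose G (z : RR * borelRn R n) := F [tuple of z.1 :: z.2] `^ p.
apply: (@measurable_integral_fst _ _ _ _ _ G) => [|z]; last exact: poweR_ge0.
by apply: measurable_fun_poweR; exact: measurable_fun_tcons.
Qed.

Lemma le_mixed_norm_rec n (p0 : R) (p : n.-tuple R) (F G : borelRn R n -> \bar R) :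
  (0 < p0)%R -> (forall j, 0 < tnth p j)%R ->
  (forall t, 0 <= F t) -> (forall t, F t <= G t) ->
  mixed_norm_rec p0 p F <= mixed_norm_rec p0 p G.
Proof.
elim: n p0 p F G => [|n IH] p0 p F G p00 pgt0 F0 FG /=.
  by apply: lee_poweR => //; rewrite invr_ge0 ltW.
have hp : (0 < thead p)%R by exact: pgt0.
apply: IH => // [j|t|t].
- by rewrite tnth_behead.
- by apply: integral_ge0 => s _; exact: poweR_ge0.
apply: le_ge0_integral => s; first exact: poweR_ge0.
by apply: lee_poweR => //; rewrite divr_ge0 ?ltW.
Qed.

Lemma mixed_norm_rec_ge0 n (p0 : R) (p : n.-tuple R) (F : borelRn R n -> \bar R) :
  0 <= mixed_norm_rec p0 p F.
Proof. by elim: n p0 p F => [|n IH] p0 p F /=; [exact: poweR_ge0|exact: IH]. Qed.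

(** Off the null set where the norm [H] in the head variable is [+oo], the section of [F] has an
    integrable power and is finite almost everywhere. Tonelli then makes the set [F = +oo] null.
    Existence of the convolution rests on this. *)
Lemma mixed_norm_rec_fin n (p : n.-tuple R) (F : borelRn R n -> \bar R) :
  (forall j, 0 < tnth p j)%R -> measurable_fun [set: borelRn R n] F ->
  (forall t, 0 <= F t) -> mixed_norm_rec 1%R p F < +oo ->
  borel_lebesgue R n [set t | F t = +oo] = 0.
Proof.
elim: n p F => [|n IH] p F pgt0 mF F0.
  rewrite /= invr1 poweRe1// => Foo.
  rewrite (_ : [set t | F t = +oo] = set0) ?measure0//.
  apply/seteqP; split => // t /=; rewrite (tuple0 t) => Ft.
  by move: Foo; rewrite Ft.
have hp : (0 < thead p)%R by exact: pgt0.
pose H (t : borelRn R n) :=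
  (\int[leb]_s F [tuple of s :: t] `^ thead p) `^ (thead p)^-1.
have mH : measurable_fun [set: borelRn R n] H by exact: measurable_norm_head.
rewrite mixed_norm_rec_cons// => Hoo.
have {Hoo}H0 : borel_lebesgue R n [set t | H t = +oo] = 0.
  apply: (IH [tuple of behead p]) => // [j|t]; first by rewrite tnth_behead.
  exact: poweR_ge0.
set E := [set t | F t = +oo].
have mset n' (G : borelRn R n' -> \bar R) : measurable_fun [set: borelRn R n'] G ->
    measurable [set t | G t = +oo].
  move=> mG; rewrite -[X in measurable X]setTI.
  exact: (mG measurableT [set +oo]).
have mE : measurable E by exact: mset.
have m1E : measurable_fun [set: borelRn R n.+1] (fun t => (\1_E t)%:E : \bar R).
  exact/measurable_EFinP.
transitivity (\int[borel_lebesgue R n.+1]_t (\1_E t)%:E).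
  by rewrite integral_indic// setIT.
rewrite integral_borel_lebesgueS//.
rewrite -(integral0 (borel_lebesgue R n) setT).
apply: ge0_ae_eq_integral => //.
- exact: (measurable_integral_fst (measurable_fun_tcons m1E)).
- by move=> t _; apply: integral_ge0 => s _; rewrite lee_fin.
exists [set t | H t = +oo]; split => //; first exact: mset.
move=> t /= /not_implyP[_] Et; apply: contrapT => Foo; apply: Et.
have mFt : measurable_fun [set: RR] (fun s => F [tuple of s :: t]).
  exact: (measurable_fun_pair1 _ (measurable_fun_tcons mF)).
have : leb.-integrable setT (fun s => F [tuple of s :: t] `^ thead p).
  apply/integrableP; split; first exact: measurable_fun_poweR.
  under eq_integral do rewrite gee0_abs ?poweR_ge0//.
  rewrite ltey; apply/eqP => foo; apply: Foo.
  by rewrite /H foo poweRyr// invr_neq0 ?gt_eqF.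
move/(integrable_ae measurableT) => ae.
rewrite -(integral0 leb setT); apply: ge0_ae_eq_integral => //.
- exact: (measurable_fun_pair1 _ (measurable_fun_tcons m1E)).
apply: filterS ae => s /(_ I) Fs _; rewrite indicE memNset//= => Fsoo.
by move: Fs; rewrite Fsoo poweRyr ?gt_eqF.
Qed.

End mixed_norm_rec.

(** * Convolution of Borel functions *)

Section borel_convolution.
Variable R : realType.
Local Notation leb := (@lebesgue_measure R).
Local Notation RR := (measurableTypeR R).

Lemma tsub_cons n (x s : R) (y t : n.-tuple R) :
  tsub [tuple of x :: y] [tuple of s :: t] = [tuple of (x - s)%R :: tsub y t].
Proof.
apply: eq_from_tnth => i; rewrite tnth_mktuple.
by case: (unliftP ord0 i) => [j|] ->; rewrite ?tnth0// !tnthS tnth_mktuple.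
Qed.

Lemma measurable_tsub n :
  measurable_fun [set: borelRn R n * borelRn R n]
    (fun z => tsub z.1 z.2 : borelRn R n).
Proof.
apply/measurable_fun_tnthP => i.
rewrite (_ : _ \o _ = fun z : borelRn R n * borelRn R n =>
    (tnth z.1 i - tnth z.2 i)%R : RR); last first.
  by apply/funext => z; rewrite /= tnth_mktuple.
by apply: measurable_funB;
  apply: (measurableT_comp (@measurable_tnth _ RR n i)).
Qed.

Lemma measurable_tsubr n (x : borelRn R n) :
  measurable_fun [set: borelRn R n] (fun t => tsub x t : borelRn R n).
Proof. exact: (measurable_fun_pair2 _ (@measurable_tsub n)). Qed.

Lemma ge0_integral_tsub n (F : borelRn R n -> \bar R) (x : borelRn R n) :
  measurable_fun [set: borelRn R n] F -> (forall t, 0 <= F t) ->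
  \int[borel_lebesgue R n]_t F (tsub x t) = \int[borel_lebesgue R n]_t F t.
Proof.
elim: n F x => [|n IH] F x mF F0.
  by apply: eq_integral => t _; rewrite (tuple0 t) (tuple0 (tsub _ _)).
have mFx := measurableT_comp mF (measurable_tsubr x).
rewrite (integral_borel_lebesgueS mF F0).
rewrite (integral_borel_lebesgueS mFx (fun t => F0 _)).
pose G (t : borelRn R n) := \int[leb]_s F [tuple of s :: t].
rewrite -(IH G [tuple of behead x]); last 2 first.
- exact: (measurable_integral_fst (measurable_fun_tcons mF)).
- by move=> t; exact: integral_ge0.
apply: eq_integral => t _; rewrite /G.
pose y := tsub [tuple of behead x] t.
transitivity (\int[leb]_s F [tuple of (thead x - s)%R :: y]).
  by apply: eq_integral => s _; rewrite -tsub_cons /= -tuple_eta.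
apply: (@ge0_integral_reflect R (fun s => F [tuple of s :: y])) => //.
exact: (measurable_fun_pair1 _ (measurable_fun_tcons mF)).
Qed.

Definition borel_convolution n (F G : borelRn R n -> \bar R) (x : borelRn R n) :=
  \int[borel_lebesgue R n]_t (F (tsub x t) * G t).

Section measurability.
Variables (n : nat) (F G : borelRn R n -> \bar R).
Hypotheses (mF : measurable_fun [set: borelRn R n] F).
Hypotheses (mG : measurable_fun [set: borelRn R n] G).

Lemma measurable_convolution_kernel :
  measurable_fun [set: borelRn R n * borelRn R n]
    (fun z => F (tsub z.1 z.2) * G z.2).
Proof.
apply: emeasurable_funM.
- exact: (measurableT_comp mF (@measurable_tsub n)).
- exact: (measurableT_comp mG).
Qed.

Lemma measurable_borel_convolution : (forall t, 0 <= F t) -> (forall t, 0 <= G t) ->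
  measurable_fun [set: borelRn R n] (borel_convolution F G).
Proof.
move=> F0 G0; apply: (measurable_integral_snd measurable_convolution_kernel) => z.
exact: mule_ge0.
Qed.
End measurability.

Lemma borel_convolution_ge0 n (F G : borelRn R n -> \bar R) x :
  (forall t, 0 <= F t) -> (forall t, 0 <= G t) -> 0 <= borel_convolution F G x.
Proof. by move=> F0 G0; apply: integral_ge0 => t _; exact: mule_ge0. Qed.

Lemma young_convolution n (p q r : n.-tuple R) (F G : borelRn R n -> \bar R) :
  (forall j, 1 <= tnth p j)%R -> (forall j, 1 <= tnth q j)%R ->
  (forall j, 1 <= tnth r j)%R ->
  (forall j, (tnth p j)^-1 + (tnth q j)^-1 = (tnth r j)^-1 + 1)%R ->
  measurable_fun [set: borelRn R n] F -> measurable_fun [set: borelRn R n] G ->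
  (forall t, 0 <= F t) -> (forall t, 0 <= G t) ->
  mixed_norm_rec 1%R r (borel_convolution F G) <=
  mixed_norm_rec 1%R p F * mixed_norm_rec 1%R q G.
Proof.
elim: n p q r F G => [|n IH] p q r F G p1 q1 r1 pqr mF mG F0 G0.
  rewrite /= invr1 !poweRe1 ?borel_convolution_ge0// /borel_convolution.
  rewrite (_ : \int[_]_t _ = \int[\d_([tuple] : borelRn R 0)]_t
    (F (tsub [tuple] t) * G t))// integral_dirac//.
    by rewrite diracE in_setT mul1e (tuple0 (tsub _ _)).
  exact: (measurable_fun_pair2 _ (measurable_convolution_kernel mF mG)).
have mFc := measurable_fun_tcons mF; have mGc := measurable_fun_tcons mG.
pose F1 (t : borelRn R n) :=
  (\int[leb]_s F [tuple of s :: t] `^ thead p) `^ (thead p)^-1.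
pose G1 (t : borelRn R n) :=
  (\int[leb]_s G [tuple of s :: t] `^ thead q) `^ (thead q)^-1.
have r0 : (0 < thead r)%R by rewrite (lt_le_trans ltr01)//; exact: r1.
rewrite (mixed_norm_rec_cons _ mF) (mixed_norm_rec_cons _ mG).
rewrite mixed_norm_rec_cons; last exact: measurable_borel_convolution.
(* The induction hypothesis bounds the convolution of the section norms [F1] and [G1]. What remains
   is a bound at each fixed [y]. *)
apply: (@le_trans _ _
    (mixed_norm_rec 1%R [tuple of behead r] (borel_convolution F1 G1))); last first.
  apply: IH => [j|j|j|j|||t|t]; rewrite ?tnth_behead//.
  - exact: measurable_norm_head.
  - exact: measurable_norm_head.
  - exact: poweR_ge0.
  - exact: poweR_ge0.
apply: le_mixed_norm_rec => // [j|t|y]; rewrite ?poweR_ge0//.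
  by rewrite tnth_behead (lt_le_trans ltr01)//; exact: r1.
(* [K (x, t)] is the convolution on the line, at [x], of the section of [F] at [y - t] with the
   section of [G] at [t]; integrating it in [t] gives the full convolution at [x :: y]. *)
pose K (z : RR * borelRn R n) := \int[leb]_s
  (F [tuple of (z.1 - s)%R :: tsub y z.2] * G [tuple of s :: z.2]).
have K0 z : 0 <= K z by apply: integral_ge0 => s _; exact: mule_ge0.
have mK : measurable_fun [set: RR * borelRn R n] K.
  pose L (w : (RR * borelRn R n) * RR) :=
    F [tuple of (w.1.1 - w.2)%R :: tsub y w.1.2] * G [tuple of w.2 :: w.1.2].
  apply: (@measurable_integral_snd _ _ _ _ _ L) => [|w]; last exact: mule_ge0.
  apply: emeasurable_funM.
  - apply: (measurableT_comp mFc
      (g := fun w : (RR * borelRn R n) * RR => ((w.1.1 - w.2)%R, tsub y w.1.2))).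
    apply: measurable_fun_pair; first apply: measurable_funB => //.
      by apply: measurableT_comp.
    by apply: (measurableT_comp (measurable_tsubr y)); apply: measurableT_comp.
  - apply: (measurableT_comp mGc
      (g := fun w : (RR * borelRn R n) * RR => (w.2, w.1.2))).
    by apply: measurable_fun_pair => //; apply: measurableT_comp.
have HK x : borel_convolution F G [tuple of x :: y] =
    \int[borel_lebesgue R n]_t K (x, t).
  rewrite /borel_convolution integral_borel_lebesgueS; last 2 first.
  - exact: (measurable_fun_pair2 _ (measurable_convolution_kernel mF mG)).
  - by move=> t; exact: mule_ge0.
  apply: eq_integral => t _; apply: eq_integral => s _.
  by rewrite tsub_cons.
under eq_integral do rewrite HK.
apply: (@le_trans _ _ (\int[borel_lebesgue R n]_t
    (\int[leb]_x K (x, t) `^ thead r) `^ (thead r)^-1)).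
  have := minkowski_integral leb (borel_lebesgue R n) mK K0 (r1 ord0).
  rewrite -/(thead r) => h.
  have J0 : 0 <= \int[borel_lebesgue R n]_t
      (\int[leb]_x K (x, t) `^ thead r) `^ (thead r)^-1.
    by apply: integral_ge0 => t _; exact: poweR_ge0.
  rewrite -[leRHS](poweRe1 J0) -[in leRHS](@divff _ (thead r)) ?gt_eqF// poweRrM.
  apply: lee_poweR => //; first by rewrite invr_ge0 ltW.
  by apply: integral_ge0 => x _; exact: poweR_ge0.
apply: le_ge0_integral => t; first exact: poweR_ge0.
apply: (@young_convolution1 R (fun s => F [tuple of s :: tsub y t])
  (fun s => G [tuple of s :: t])) => //.
- exact: (measurable_fun_pair1 _ mFc).
- exact: (measurable_fun_pair1 _ mGc).
- exact: p1.
- exact: q1.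
- exact: r1.
- exact: pqr.
Qed.

End borel_convolution.

(** * Lebesgue measurable functions *)

Section borel_representatives.
Variables (R : realType) (n : nat).
Local Notation BR := (borelRn R n).
Local Notation mu := (borel_lebesgue R n).

Lemma null_reflect (N : set BR) (x : BR) : measurable N -> mu N = 0 ->
  measurable [set t | N (tsub x t)] /\ mu [set t | N (tsub x t)] = 0.
Proof.
move=> mN N0; have mNx : measurable [set t | N (tsub x t)].
  by rewrite -[X in measurable X]setTI; exact: measurable_tsubr.
split=> //; transitivity (\int[mu]_t (\1_N (tsub x t))%:E).
  rewrite (_ : (fun _ => _) = EFin \o \1_[set t | N (tsub x t)])//.
  by rewrite integral_indic// setIT.
rewrite (@ge0_integral_tsub R n (EFin \o \1_N))/=.
- by rewrite integral_indic// setIT; exact: N0.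
- exact/measurable_EFinP.
- by move=> t; rewrite lee_fin.
Qed.

Variables (f g u v : BR -> R) (Nf Ng : set BR).
Hypotheses (mu_ : measurable_fun [set: BR] u) (mv : measurable_fun [set: BR] v).
Hypotheses (mNf : measurable Nf) (Nf0 : mu Nf = 0).
Hypotheses (mNg : measurable Ng) (Ng0 : mu Ng = 0).
Hypotheses (fu : forall t, ~ Nf t -> f t = u t) (gv : forall t, ~ Ng t -> g t = v t).

Lemma measurable_convolution_integrand x :
  measurable_fun [set: BR] (fun t => (convolution_integrand u v x t)%:E).
Proof.
apply/measurable_EFinP; apply: measurable_funM => //.
exact: (measurableT_comp mu_ (measurable_tsubr x)).
Qed.

Lemma convolution_integrand_off_null x : exists M : set BR, [/\ measurable M,
  mu M = 0 & forall t, ~ M t ->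
    convolution_integrand f g x t = convolution_integrand u v x t].
Proof.
have [mNx Nx0] := null_reflect x mNf Nf0.
exists ([set t | Nf (tsub x t)] `|` Ng); split.
- exact: measurableU.
- apply/negligibleP; first exact: measurableU.
  by apply: negligibleU; apply/negligibleP.
- move=> t /not_orP[Nfx Ngt]; rewrite /convolution_integrand.
  by rewrite fu// gv.
Qed.

(** The Carathéodory measure is complete, so a function equal almost everywhere to a Borel one is
    measurable. *)
Lemma measurable_convolution_integrand_Rn x :
  measurable_fun [set: lebesgueRn R n]
    (fun t => (convolution_integrand f g x t)%:E).
Proof.
have [M [mM M0 MP]] := convolution_integrand_off_null x.
apply: (@ae_measurable_fun _ _ R (@lebesgue_Rn R n) _ setT
  (fun t => (convolution_integrand u v x t)%:E)).
- exact: measure_is_complete_caratheodory.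
- exists M; split.
  + exact: lebesgue_Rn_measurable.
  + exact: (etrans (lebesgue_RnE mM) M0).
  + by move=> t /= /not_implyP[_]; apply: contra_notP => Mt; rewrite MP.
- exact: measurable_fun_lebesgueRn (measurable_convolution_integrand x).
Qed.

(** Taking for [h] the absolute value, the positive part and the negative part covers both
    integrability and the value of the signed integral. *)
Let integral_replace (h : R -> \bar R) x :
  measurable_fun [set: R] h -> (forall s, 0 <= h s) ->
  \int[@lebesgue_Rn R n]_t h (convolution_integrand f g x t) =
  \int[mu]_t h (convolution_integrand u v x t).
Proof.
move=> mh h0; have [M [mM M0 MP]] := convolution_integrand_off_null x.
rewrite -integral_lebesgue_Rn//; last first.
  apply: (measurableT_comp mh); apply/measurable_EFinP.
  exact: measurable_convolution_integrand.
apply: (@eq_integral_off_null _ (lebesgueRn R n) R (@lebesgue_Rn R n) M)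
  => [||t|t|t Mt].
- exact: lebesgue_Rn_measurable.
- exact: (etrans (lebesgue_RnE mM) M0).
- exact: h0.
- exact: h0.
- by rewrite MP.
Qed.

Lemma integral_abs_convolution_integrand x :
  \int[@lebesgue_Rn R n]_t `|(convolution_integrand f g x t)%:E| =
  borel_convolution (fun t => `|u t|%:E) (fun t => `|v t|%:E) x.
Proof.
rewrite (integral_replace x (h := fun s : R => `|s%:E|))//; last first.
  by apply: measurableT_comp; [exact: abse_measurable|exact: EFin_measurable].
by apply: eq_integral => t _; rewrite /= normrM EFinM.
Qed.

Lemma convolutionE x : convolution f g x =
  fine (\int[mu]_t (convolution_integrand u v x t)%:E).
Proof.
rewrite /convolution /Rintegral; congr fine; rewrite integralE [RHS]integralE.

have posE (T : Type) (w : T -> R) :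
    (fun t => (w t)%:E)^\+ = (fun t => EFin^\+ (w t)).
  by apply/funext => t; rewrite !funepos.unlock.
have negE (T : Type) (w : T -> R) :
    (fun t => (w t)%:E)^\- = (fun t => EFin^\- (w t)).
  by apply/funext => t; rewrite !funeneg.unlock.
rewrite !posE !negE; congr (_ - _); apply: integral_replace => [|s].
- by apply: measurable_funepos; exact: EFin_measurable.
- exact: funepos_ge0.
- by apply: measurable_funeneg; exact: EFin_measurable.
- exact: funeneg_ge0.
Qed.

(** This holds at every [x], also where the integral is infinite: [fine] sends infinite values to 0,
    which can only decrease the absolute value. *)
Lemma le_norm_convolution x : `|convolution f g x|%:E <=
  borel_convolution (fun t => `|u t|%:E) (fun t => `|v t|%:E) x.
Proof.
rewrite convolutionE; apply: (@le_trans _ _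
    `|\int[mu]_t (convolution_integrand u v x t)%:E|).
  by case: (\int[mu]_t _) => [a| |]/=; rewrite ?normr0 ?lee_fin ?leey.
apply: le_trans (le_abse_integral _ _ _) _ => //.
  exact: measurable_convolution_integrand.
by under eq_integral do rewrite /= normrM EFinM.
Qed.

(** Since [convolutionE] holds at every [x], the convolution is itself Borel: it is [fine] of a
    difference of two Tonelli integrals. *)
Lemma lebesgue_measurable_convolution : lebesgue_measurable (convolution f g).
Proof.
rewrite /lebesgue_measurable (_ : convolution f g =
    fun x => fine (\int[mu]_t (convolution_integrand u v x t)%:E)); last first.
  by apply/funext => x; exact: convolutionE.
apply: (@measurable_fun_lebesgueRn R _ R n).
apply: (measurableT_comp (fine_measurable measurableT)).
pose k (z : BR * BR) : \bar R := (convolution_integrand u v z.1 z.2)%:E.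
have mk : measurable_fun [set: BR * BR] k.
  apply/measurable_EFinP; apply: measurable_funM.
  - exact: (measurableT_comp mu_ (@measurable_tsub R n)).
  - exact: (measurableT_comp mv measurable_snd).
rewrite (_ : (fun x => _) = fun x =>
    \int[mu]_t k^\+ (x, t) - \int[mu]_t k^\- (x, t)); last first.
  apply/funext => x; rewrite integralE.
  by congr (_ - _); apply: eq_integral => t _; rewrite ?funeposE ?funenegE.
apply: emeasurable_funB.
- apply: measurable_integral_snd; first exact: measurable_funepos.
  exact: funepos_ge0.
- apply: measurable_integral_snd; first exact: measurable_funeneg.
  exact: funeneg_ge0.
Qed.

End borel_representatives.

Theorem theorem3p1 (R : realType) (n : nat) (n_gt0 : (0 < n)%N)
    (p q r : n.-tuple R)
    (p_ge1 : forall j : 'I_n, (1 <= tnth p j)%R)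
    (q_ge1 : forall j : 'I_n, (1 <= tnth q j)%R)
    (r_ge1 : forall j : 'I_n, (1 <= tnth r j)%R)
    (pqr : forall j : 'I_n,
      ((tnth p j)^-1 + (tnth q j)^-1 = (tnth r j)^-1 + 1)%R)
    (f g : n.-tuple R -> R) (fL : mixedL p f) (gL : mixedL q g) :
  [/\ {ae @lebesgue_Rn R n, forall x,
        (@lebesgue_Rn R n).-integrable [set: lebesgueRn R n]
          (fun t => (convolution_integrand f g x t)%:E)},
      lebesgue_measurable (convolution f g) &
      mixed_norm r (convolution f g) <= mixed_norm p f * mixed_norm q g].
Proof.
have [mf foo] := fL; have [mg goo] := gL.
have [u [Nf [mu mNf Nf0 fu]]] := caratheodory_fun_eq_off_null mf.
have [v [Ng [mv mNg Ng0 gv]]] := caratheodory_fun_eq_off_null mg.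
pose F (t : borelRn R n) := `|u t|%:E.
pose G (t : borelRn R n) := `|v t|%:E.
have F0 t : 0 <= F t by rewrite lee_fin.
have G0 t : 0 <= G t by rewrite lee_fin.
have mF : measurable_fun [set: borelRn R n] F.
  by apply/measurable_EFinP; exact: measurableT_comp.
have mG : measurable_fun [set: borelRn R n] G.
  by apply/measurable_EFinP; exact: measurableT_comp.
have r0 j : (0 < tnth r j)%R by rewrite (lt_le_trans ltr01).
have fF : mixed_norm p f = mixed_norm_rec 1%R p F.
  apply: (mixed_norm_rec_off_null 1%R p (F := fun t => `|f t|%:E) mNf Nf0) => // t Nt.
  by rewrite /F fu.
have gG : mixed_norm q g = mixed_norm_rec 1%R q G.
  apply: (mixed_norm_rec_off_null 1%R q (F := fun t => `|g t|%:E) mNg Ng0) => // t Nt.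
  by rewrite /G gv.
have mH := measurable_borel_convolution mF mG F0 G0.
have young := young_convolution p_ge1 q_ge1 r_ge1 pqr mF mG F0 G0.
split.
(* The exceptional set is where the convolution of [|u|] and [|v|] is [+oo]; elsewhere its finite
   value is the integral of the absolute value of the integrand. *)
- have Hoo : mixed_norm_rec 1%R r (borel_convolution F G) < +oo.
    apply: (le_lt_trans young); rewrite -fF -gG.
    apply: lte_mul_pinfty => //; first exact: mixed_norm_rec_ge0.
    by rewrite ge0_fin_numE// mixed_norm_rec_ge0.
  have mE : measurable [set x | borel_convolution F G x = +oo].
    rewrite -[X in measurable X]setTI.
    exact: (mH measurableT [set +oo]).
  exists [set x | borel_convolution F G x = +oo]; split.
  + exact: lebesgue_Rn_measurable.
  + apply: (etrans (lebesgue_RnE mE)); apply: (mixed_norm_rec_fin r0 mH) => // t.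
    exact: borel_convolution_ge0.
  move=> x /=; apply: contra_notP => Hx; apply/integrableP; split.
    exact: (measurable_convolution_integrand_Rn mu mv mNf Nf0 mNg Ng0 fu gv).
  rewrite (integral_abs_convolution_integrand mu mv mNf Nf0 mNg Ng0 fu gv).
  by rewrite ltey; apply/eqP.
- exact: (lebesgue_measurable_convolution mu mv mNf Nf0 mNg Ng0 fu gv).
- rewrite fF gG; apply: le_trans young.
  apply: (@le_mixed_norm_rec R n 1%R r (fun x => `|convolution f g x|%:E)) => // x.
  exact: (le_norm_convolution mu mv mNf Nf0 mNg Ng0 fu gv).
Qed.
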